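(* Let $g\in\mathbb{N}$ and $n\in\mathbb{N}_{>0}$. The set $$\Big\{\, l_{u_1,i_1}^{a_1}\cdots l_{u_m,i_m}^{a_m}\,w \ \Big|\ w\in\mathrm{S}_n,\ m\in\mathbb{N},\ (a_1,\dots,a_m)\in\mathbb{Z}^m,\ (u_j,i_j)\in\{1,\dots,g\}\times\{1,\dots,n\}\ (1\le j\le m),\ i_1\le\dots\le i_m\Big\}$$ is a $\mathbb{Z}$-basis of the group ring $\mathbb{Z}\mathrm{W}_{g,n}$ of the handlebody Coxeter group $\mathrm{W}_{g,n}$.
   Context: The handlebody Coxeter group $\mathrm{W}_{g,n}$ (in $n$ strands and of genus $g$) is the group generated by $t_u$ ($1\le u\le g$) and $s_i$ ($1\le i\le n-1$) subject to $s_i^2=1$; $s_is_j=s_js_i$ if $|i-j|>1$; $s_is_js_i=s_js_is_j$ if $|i-j|=1$; $t_us_i=s_it_u$ if $i>1$; and $t_v(s_1t_us_1)=(s_1t_us_1)t_v$ for all $u,v$. Relations involving indices out of range are vacuous. The symmetric group $\mathrm{S}_n$ is viewed as the subgroup of $\mathrm{W}_{g,n}$ generated by the $s_i$ (simple transpositions). The Jucys–Murphy elements are $l_{u,1}=t_u$ and $l_{u,i}=s_{i-1}\cdots s_1t_us_1\cdots s_{i-1}$ for $1<i\le n$. The displayed family is understood as a set of elements of $\mathbb{Z}\mathrm{W}_{g,n}$ (different index choices may describe the same element). *)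

(* Defs.v *)
From HB Require Import structures.
From mathcomp Require Import all_boot all_order all_algebra finmap.
From mathcomp Require Import boolp classical_sets.
From mathcomp Require Import monalg.

Set Implicit Arguments.
Unset Strict Implicit.
Unset Printing Implicit Defensive.

Import GRing.Theory.
Local Open Scope fset_scope.
Local Open Scope ring_scope.

(* The letter (x, false) stands for x and (x, true) for the inverse of x. *)
Definition word (X : choiceType) := seq (X * bool).

Definition word_inv (X : choiceType) (w : word X) : word X :=
  rev [seq (p.1, ~~ p.2) | p <- w].

Lemma word_invK (X : choiceType) : involutive (@word_inv X).
Proof.
move=> w; rewrite /word_inv map_rev revK -map_comp -[RHS]map_id.
by apply: eq_map => -[x b] /=; rewrite negbK.
Qed.

Section PresentedGroup.
Variables (X : choiceType) (rels : word X -> word X -> Prop).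

Inductive pres_eq : word X -> word X -> Prop :=
| pres_refl u : pres_eq u u
| pres_sym u v : pres_eq u v -> pres_eq v u
| pres_trans u v w : pres_eq u v -> pres_eq v w -> pres_eq u w
| pres_cat u u' v v' :
    pres_eq u u' -> pres_eq v v' -> pres_eq (u ++ v) (u' ++ v')
| pres_cancel x b : pres_eq [:: (x, b); (x, ~~ b)] [::]
| pres_rel u v : rels u v -> pres_eq u v.

Lemma pres_invl w : pres_eq (word_inv w ++ w) [::].
Proof.
elim: w => [|[x b] w IHw]; first exact: pres_refl.
rewrite /word_inv /= rev_cons cat_rcons; apply: pres_trans IHw.
apply: pres_cat; first exact: pres_refl.
rewrite -cat1s -(cat1s _ w) catA -[X in pres_eq _ X]cat0s.
apply: pres_cat; last exact: pres_refl.
by rewrite -[in (x, b)](negbK b) /=; apply: pres_cancel.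
Qed.

Lemma pres_invr w : pres_eq (w ++ word_inv w) [::].
Proof. by rewrite -[w in w ++ _]word_invK; apply: pres_invl. Qed.

Lemma pres_inv u v : pres_eq u v -> pres_eq (word_inv u) (word_inv v).
Proof.
move=> uv; apply: (@pres_trans _ (word_inv u ++ (v ++ word_inv v))).
  rewrite -[X in pres_eq X]cats0; apply: pres_cat; first exact: pres_refl.
  exact/pres_sym/pres_invr.
rewrite catA -[X in pres_eq _ X]cat0s; apply: pres_cat; last exact: pres_refl.
apply: pres_trans (pres_invl u); apply: pres_cat; first exact: pres_refl.
exact: pres_sym.
Qed.

Let pres_eqb : rel (word X) := fun u v => `[< pres_eq u v >].

Let pres_eqb_equiv : equiv_class_of pres_eqb.
Proof.
split=> [u|u v|v u w].
- exact/asboolP/pres_refl.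
- by apply/asboolP/asboolP => /pres_sym.
- by move=> /asboolP uv /asboolP vw; apply/asboolP/(pres_trans uv).
Qed.

Definition pres_equiv : equiv_rel (word X) := EquivRelPack pres_eqb_equiv.

Definition pgroup := {eq_quot pres_equiv}%qT.

HB.instance Definition _ := Choice.on pgroup.

Definition pclass (w : word X) : pgroup := \pi_({eq_quot pres_equiv})%qT w.
Definition prepr (a : pgroup) : word X := repr a.

Lemma preprK a : pclass (prepr a) = a.
Proof. exact: reprK. Qed.

Lemma pclassP u v : pclass u = pclass v <-> pres_eq u v.
Proof.
split=> [/eqP|uv]; first by rewrite /pclass eqmodE => /asboolP.
by apply/eqP; rewrite /pclass eqmodE; apply/asboolP.
Qed.

Lemma prepr_eq w : pres_eq (prepr (pclass w)) w.
Proof. by apply/pclassP; rewrite preprK. Qed.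

Definition pgroup_one : pgroup := pclass [::].
Definition pgroup_mul (a b : pgroup) : pgroup := pclass (prepr a ++ prepr b).
Definition pgroup_inv (a : pgroup) : pgroup := pclass (word_inv (prepr a)).

Lemma pgroup_mulE u v :
  pgroup_mul (pclass u) (pclass v) = pclass (u ++ v).
Proof. by apply/pclassP/pres_cat; apply: prepr_eq. Qed.

Lemma pgroup_invE u : pgroup_inv (pclass u) = pclass (word_inv u).
Proof. exact/pclassP/pres_inv/prepr_eq. Qed.

Lemma pgroup_mulA : associative pgroup_mul.
Proof.
move=> a b c; rewrite -[a]preprK -[b]preprK -[c]preprK.
by rewrite !pgroup_mulE catA.
Qed.

Lemma pgroup_mul1 : left_id pgroup_one pgroup_mul.
Proof. by move=> a; rewrite -[a]preprK pgroup_mulE. Qed.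

Lemma pgroup_mulr1 : right_id pgroup_one pgroup_mul.
Proof. by move=> a; rewrite -[a]preprK pgroup_mulE cats0. Qed.

Lemma pgroup_mulV : left_inverse pgroup_one pgroup_inv pgroup_mul.
Proof.
move=> a; rewrite -[a]preprK pgroup_invE pgroup_mulE.
exact/pclassP/pres_invl.
Qed.

Lemma pgroup_mulrV : right_inverse pgroup_one pgroup_inv pgroup_mul.
Proof.
move=> a; rewrite -[a]preprK pgroup_invE pgroup_mulE.
exact/pclassP/pres_invr.
Qed.

HB.instance Definition _ := isGroup.Build pgroup
  pgroup_mulA pgroup_mul1 pgroup_mulr1 pgroup_mulV pgroup_mulrV.

Definition pgen (x : X) : pgroup := pclass [:: (x, false)].

Definition word_eval (G : groupType) (f : X -> G) (w : word X) : G :=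
  (\prod_(p <- w) (if p.2 then (f p.1)^-1 else f p.1))%g.

Lemma word_eval_pgen w : word_eval pgen w = pclass w.
Proof.
rewrite /word_eval; elim: w => [|[x b] w IHw]; first by rewrite big_nil.
rewrite big_cons IHw -cat1s -pgroup_mulE; congr (_ * _)%g.
by case: b => //=; rewrite [LHS]pgroup_invE.
Qed.

Lemma pgroup_universal (G : groupType) (f : X -> G) :
  (forall u v, rels u v -> word_eval f u = word_eval f v) ->
  exists! phi : pgroup -> G,
    {morph phi : a b / (a * b)%g >-> (a * b)%g} /\ forall x, phi (pgen x) = f x.
Proof.
move=> frels; have fP u v : pres_eq u v -> word_eval f u = word_eval f v.
  rewrite /word_eval; elim=> // {u v}.
  - by move=> u v w _ -> _ ->.
  - by move=> u u' v v' _ Hu _ Hv; rewrite !big_cat /= Hu Hv.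
  - move=> x b; rewrite !big_cons !big_nil mulg1.
    by case: b => /=; rewrite ?mulVg ?mulgV.
exists (word_eval f \o prepr); split; first split.
- move=> a b /=; rewrite /word_eval -big_cat /=; apply: fP.
  by apply/pclassP; rewrite preprK.
- by move=> x /=; rewrite (fP _ _ (prepr_eq _)) /word_eval big_seq1.
move=> phi [phiM phi_gen]; apply/funext => a /=.
have phi1 : phi 1%g = 1%g.
  by apply: (mulgI (phi 1%g)); rewrite -phiM !mulg1.
rewrite -[in RHS](preprK a) -word_eval_pgen /word_eval.
rewrite (big_morph phi phiM phi1); apply: eq_bigr => -[x b] _ /=.
case: b => /=; last by rewrite phi_gen.
by apply: mulg1_eq; rewrite -phi_gen -phiM mulgV.
Qed.

End PresentedGroup.

(* monalg equips {malg R[K]} with a product only for monoids K without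
   nontrivial invertible elements, so the convolution product for a group is
   defined here, on top of the module structure of {malg R[G]}. *)
Definition group_alg (R : nzRingType) (G : groupType) := {malg R[G]}.

Section GroupAlgebra.
Variables (R : nzRingType) (G : groupType).

HB.instance Definition _ := Choice.on (group_alg R G).
HB.instance Definition _ := GRing.Lmodule.on (group_alg R G).

Implicit Types (x y z : group_alg R G) (a b : G).

Definition galg_mul x y : group_alg R G :=
  \sum_(a <- msupp x) \sum_(b <- msupp y) mkmalgU (a * b)%g (x@_a * y@_b).

Definition galg_of (a : G) : group_alg R G := mkmalgU a 1.

Lemma galg_mulw (d1 d2 : {fset G}) x y :
  msupp x `<=` d1 -> msupp y `<=` d2 ->
  galg_mul x y =
    \sum_(a <- d1) \sum_(b <- d2) mkmalgU (a * b)%g (x@_a * y@_b).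
Proof.
move=> le_d1 le_d2; rewrite /galg_mul (big_fset_incl _ le_d1) /=.
  apply/eq_bigr=> a _; apply/big_fset_incl => // b _ /mcoeff_outdom ->.
  by rewrite mulr0 monalgU0.
move=> a _ /mcoeff_outdom xa.
by rewrite big1 => // b _; rewrite xa mul0r monalgU0.
Qed.

Lemma galg_mulUU (c d : R) a b :
  galg_mul (mkmalgU a c) (mkmalgU b d) = mkmalgU (a * b)%g (c * d).
Proof.
by rewrite (galg_mulw msuppU_le msuppU_le) !big_seq_fset1 !mcoeffUU.
Qed.

Lemma galg_mulDl : left_distributive galg_mul +%R.
Proof.
move=> x y z; rewrite (galg_mulw (msuppD_le x y) (fsubset_refl _)).
rewrite (galg_mulw (fsubsetUl (msupp x) (msupp y)) (fsubset_refl _)).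
rewrite (galg_mulw (fsubsetUr (msupp x) (msupp y)) (fsubset_refl _)).
rewrite -big_split /=; apply/eq_bigr=> a _.
rewrite -big_split /=; apply/eq_bigr=> b _.
by rewrite mcoeffD mulrDl monalgUD.
Qed.

Lemma galg_mulDr : right_distributive galg_mul +%R.
Proof.
move=> z x y; rewrite (galg_mulw (fsubset_refl _) (msuppD_le x y)).
rewrite (galg_mulw (fsubset_refl _) (fsubsetUl (msupp x) (msupp y))).
rewrite (galg_mulw (fsubset_refl _) (fsubsetUr (msupp x) (msupp y))).
rewrite -big_split /=; apply/eq_bigr=> a _.
rewrite -big_split /=; apply/eq_bigr=> b _.
by rewrite mcoeffD mulrDr monalgUD.
Qed.

Lemma galg_mul0l : left_zero 0 galg_mul.
Proof. by move=> x; rewrite /galg_mul msupp0 big_seq_fset0. Qed.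

Lemma galg_mul0r : right_zero 0 galg_mul.
Proof.
by move=> x; rewrite /galg_mul msupp0 big1 // => a _; rewrite big_seq_fset0.
Qed.

Lemma galg_mul1 : left_id (galg_of 1%g) galg_mul.
Proof.
move=> x; rewrite (galg_mulw msuppU_le (fsubset_refl _)) big_seq_fset1.
rewrite [RHS]monalgE; apply/eq_bigr => b _.
by rewrite mcoeffUU mul1r mul1g.
Qed.

Lemma galg_mulr1 : right_id (galg_of 1%g) galg_mul.
Proof.
move=> x; rewrite (galg_mulw (fsubset_refl _) msuppU_le) [RHS]monalgE.
by apply/eq_bigr => a _; rewrite big_seq_fset1 mcoeffUU mulr1 mulg1.
Qed.

Lemma galg_mulA : associative galg_mul.
Proof.
have suml I (s : seq I) (F : I -> group_alg R G) y :
    galg_mul (\sum_(i <- s) F i) y = \sum_(i <- s) galg_mul (F i) y.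
  by apply: (big_morph (galg_mul^~ y) _ (galg_mul0l y)) => ? ?;
    apply: galg_mulDl.
have sumr I (s : seq I) (F : I -> group_alg R G) y :
    galg_mul y (\sum_(i <- s) F i) = \sum_(i <- s) galg_mul y (F i).
  by apply: (big_morph (galg_mul y) _ (galg_mul0r y)) => ? ?;
    apply: galg_mulDr.
move=> x y z.
rewrite [x]monalgE (suml _ _ _ (galg_mul y z)) (suml _ _ _ y) (suml _ _ _ z).
apply: eq_bigr => a _; set xa := mkmalgU a _.
rewrite [y]monalgE (suml _ _ _ z) (sumr _ _ _ xa) (sumr _ _ _ xa).
rewrite (suml _ _ _ z); apply: eq_bigr => b _; set yb := mkmalgU b _.
rewrite [z]monalgE (sumr _ _ _ yb) (sumr _ _ _ xa).
rewrite (sumr _ _ _ (galg_mul xa yb)); apply: eq_bigr => c _.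
by rewrite !galg_mulUU mulrA mulgA.
Qed.

Lemma galg_oner_neq0 : galg_of 1%g != 0.
Proof. by apply/eqP/malgP=> /(_ 1%g) /eqP; rewrite !mcoeffsE oner_eq0. Qed.

HB.instance Definition _ := GRing.Zmodule_isNzRing.Build (group_alg R G)
  galg_mulA galg_mul1 galg_mulr1 galg_mulDl galg_mulDr galg_oner_neq0.

Lemma galg_of1 : galg_of 1%g = 1.
Proof. by []. Qed.

Lemma galg_ofM a b : galg_of (a * b)%g = galg_of a * galg_of b.
Proof. by rewrite [RHS]galg_mulUU mulr1. Qed.

End GroupAlgebra.

Section Basis.
Variables (R : nzRingType) (M : lmodType R) (B : set M).

Definition lin_independent : Prop :=
  forall (s : seq M) (c : M -> R), uniq s -> (forall x, x \in s -> B x) ->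
    \sum_(x <- s) c x *: x = 0 -> forall x, x \in s -> c x = 0.

Definition spanning : Prop :=
  forall y : M, exists (s : seq M) (c : M -> R),
    (forall x, x \in s -> B x) /\ y = \sum_(x <- s) c x *: x.

Definition is_basis : Prop := lin_independent /\ spanning.

End Basis.

Section GroupNotions.
Variable G : groupType.

Definition expgz (x : G) (a : int) : G :=
  match a with Posz k => (x ^+ k)%g | Negz k => (x ^- k.+1)%g end.

Definition generated_subgroup (A : set G) : set G :=
  [set x | forall H : {pred G}, group_closed H ->
             (forall y, A y -> y \in H) -> x \in H].

End GroupNotions.

(* Indices are shifted by one: inl u stands for t_(u+1) and inr i for
   s_(i+1), and similarly for the Jucys-Murphy elements below. *)
Definition hgen (g n : nat) := ('I_g + 'I_n.-1)%type.

Section HandlebodyCoxeter.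
Variables g n : nat.

Let t (u : 'I_g) : hgen g n * bool := (inl u, false).
Let s (i : 'I_n.-1) : hgen g n * bool := (inr i, false).

Inductive hrel : word (hgen g n) -> word (hgen g n) -> Prop :=
| hrel_ss i : hrel [:: s i; s i] [::]
| hrel_comm (i j : 'I_n.-1) : ((i.+1 < j) || (j.+1 < i))%N ->
    hrel [:: s i; s j] [:: s j; s i]
| hrel_braid (i j : 'I_n.-1) : (i.+1 == j) || (j.+1 == i) ->
    hrel [:: s i; s j; s i] [:: s j; s i; s j]
| hrel_ts u (i : 'I_n.-1) : (0 < i)%N -> hrel [:: t u; s i] [:: s i; t u]
| hrel_tt u v (i : 'I_n.-1) : i = 0%N :> nat ->
    hrel [:: t v; s i; t u; s i] [:: s i; t u; s i; t v].

Definition handlebody := pgroup hrel.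

HB.instance Definition _ := Group.on handlebody.

Definition ht (u : 'I_g) : handlebody := pgen hrel (inl u).
Definition hs (i : 'I_n.-1) : handlebody := pgen hrel (inr i).

Definition hSym : set handlebody := generated_subgroup (range hs).

(* For i = 0 both products are empty and the value is ht u. *)
Definition JM (u : 'I_g) (i : 'I_n) : handlebody :=
  ((\prod_(k <- rev (enum 'I_n.-1) | (k < i)%N) hs k) * ht u *
   (\prod_(k <- enum 'I_n.-1 | (k < i)%N) hs k))%g.

End HandlebodyCoxeter.

(* Main.v *)
Require Import Defs.
From mathcomp Require Import all_boot all_order all_algebra.
From mathcomp Require Import boolp classical_sets.
From mathcomp Require Import finmap monalg.

Set Implicit Arguments.
Unset Strict Implicit.
Unset Printing Implicit Defensive.

(** The displayed elements are all group elements, and distinct group elements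
    are linearly independent in the group ring; hence the set is a basis as
    soon as it contains every group element ([group_elements_basis]), i.e. as
    soon as every element of the group is a product of powers of
    Jucys-Murphy elements with nondecreasing second indices, times an element
    of the symmetric group.  Repetitions in the displayed family do no harm,
    because the family is read as a set.

    Two facts give this normal form.  First, a simple transposition conjugates
    Jucys-Murphy elements into one another ([hs_JM]): [hs k] exchanges the
    positions k and k + 1 and fixes the others, which for large positions is
    where the braid relation enters.  Consequently the products of powers of
    Jucys-Murphy elements, in any order, times permutations, are stable under
    left multiplication by all generators and their inverses, and exhaust the
    group ([JM_factorization]).  Second, Jucys-Murphy elements at different
    positions commute ([JM_commute]): the defining relation is the case of
    positions 0 and 1, and the others follow by conjugation.  So the factors
    can be sorted by position without disturbing the relative order of those
    at the same position ([commuting_sort]). *)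

Local Open Scope classical_set_scope.

(** * Group elements as a basis of the group ring *)

Section GroupRing.
Variables (R : nzRingType) (G : groupType).
Import GRing.Theory.
Local Open Scope ring_scope.

Lemma galg_of_coeff (a b : G) : (galg_of R a)@_b = (a == b)%:R.
Proof. by rewrite mcoeffU. Qed.

Lemma galg_of_inj : injective (@galg_of R G).
Proof.
move=> a b /(congr1 (mcoeff b)); rewrite !galg_of_coeff eqxx.
by case: eqP => // _ /eqP; rewrite eq_sym oner_eq0.
Qed.

Lemma galg_of_independent (A : set G) :
  @lin_independent R (group_alg R G) (@galg_of R G @` A).
Proof.
move=> s c s_uniq sA sum0 x xs; have [a _ ax] := sA x xs.
have /(congr1 (mcoeff a)) := sum0; rewrite raddf_sum mcoeff0 /=.
rewrite (bigD1_seq x) //= big_seq_cond big1 => [|y /andP[ys yx]].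
  by rewrite mcoeffZ -ax galg_of_coeff eqxx mulr1 addr0.
have [b _ bE] := sA y ys; rewrite mcoeffZ -bE galg_of_coeff.
case: eqP => [ba|_]; last by rewrite mulr0.
by rewrite -bE -ax ba eqxx in yx.
Qed.

Lemma galg_of_spanning : @spanning R (group_alg R G) (range (@galg_of R G)).
Proof.
move=> y; pose elt (z : group_alg R G) := xget 1%g [set a | galg_of R a = z].
have eltK a : elt (galg_of R a) = a.
  by apply: galg_of_inj; rewrite /elt; case: xgetP => [? _ //|/(_ a)/(_ erefl)].
exists [seq galg_of R a | a <- msupp y], (fun z => y@_(elt z)); split.
  by move=> x /mapP[a _ ->]; exists a.
rewrite big_map [LHS]monalgE; apply: eq_bigr => a _; rewrite eltK.
by apply/malgP => b; rewrite mcoeffZ !mcoeffU mulr_natr.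
Qed.

Lemma group_elements_basis (B : set (group_alg R G)) :
  B = range (@galg_of R G) -> is_basis B.
Proof.
by move=> ->; split; [exact: galg_of_independent | exact: galg_of_spanning].
Qed.

End GroupRing.

(** * Integer powers and sorting of products *)

Section Groups.
Variable G : groupType.
Local Open Scope group_scope.

Lemma expgz_intertwine (h x y : G) a :
  h * x = y * h -> h * expgz x a = expgz y a * h.
Proof.
move=> hxy; have hX k : h * x ^+ k = y ^+ k * h.
  elim: k => [|k IHk]; first by rewrite !expg0 mulg1 mul1g.
  by rewrite !expgS mulgA hxy -mulgA IHk mulgA.
case: a => k /=; first exact: hX.
by apply: (mulgI (y ^+ k.+1)); rewrite mulgA -hX mulgK mulVKg.
Qed.

Lemma expgz_commute (x y : G) a b :
  commute x y -> commute (expgz x a) (expgz y b).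
Proof.
by move=> xy; apply/expgz_intertwine/commute_sym/expgz_intertwine/commute_sym.
Qed.

Section CommutingSort.
Variables (T : eqType) (le : rel T) (F : T -> G).
Hypotheses (le_total : total le) (le_trans : transitive le).
Hypothesis F_comm : forall x y, ~~ le x y -> commute (F x) (F y).

Lemma commuting_insert x s : sorted le s ->
  exists s', [/\ sorted le s', perm_eq s' (x :: s) &
                 \prod_(y <- s') F y = F x * \prod_(y <- s) F y].
Proof.
elim: s => [_|y s IHs ys_sorted].
  by exists [:: x]; rewrite big_seq1 big_nil mulg1.
have [le_xy|not_le_xy] := boolP (le x y).
  by exists [:: x, y & s]; rewrite big_cons /= le_xy.
have le_yx : le y x by have := le_total x y; rewrite (negbTE not_le_xy).
have [s' [s'_sorted s'_perm s'_prod]] := IHs (path_sorted ys_sorted).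
exists (y :: s'); split.
- rewrite /= path_min_sorted // (perm_all _ s'_perm) /= le_yx.
  exact: (order_path_min le_trans).
- apply: (perm_trans (_ : perm_eq _ [:: y, x & s])); first by rewrite perm_cons.
  exact/permPl/(perm_catCA [:: y] [:: x] s).
- by rewrite !big_cons s'_prod !mulgA (F_comm not_le_xy).
Qed.

(** A product may be sorted along a preorder when strictly decreasing pairs
    of factors commute; factors that are equivalent for the preorder need not
    commute, and insertion never exchanges them. *)
Lemma commuting_sort s :
  exists2 s', sorted le s' & \prod_(y <- s') F y = \prod_(y <- s) F y.
Proof.
elim: s => [|x s [s1 s1_sorted s1_prod]]; first by exists [::].
have [s' [s'_sorted _ s'_prod]] := commuting_insert x s1_sorted.
by exists s' => //; rewrite s'_prod s1_prod big_cons.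
Qed.

End CommutingSort.

End Groups.

(** * The handlebody Coxeter group *)

Section Handlebody.
Variables g n : nat.
Local Open Scope group_scope.
Local Notation W := (handlebody g n).
Implicit Types (u v : 'I_g) (i j : 'I_n) (k l : 'I_n.-1).

Lemma hrel_eval p q : hrel p q ->
  word_eval (pgen (@hrel g n)) p = word_eval (pgen (@hrel g n)) q.
Proof. by move=> pq; rewrite !word_eval_pgen; apply/pclassP/pres_rel. Qed.

Lemma hs_mul k : hs g k * hs g k = 1.
Proof.
have := hrel_eval (hrel_ss g k).
by rewrite /word_eval !big_cons !big_nil !mulg1.
Qed.

Lemma hs_inv k : (hs g k)^-1 = hs g k.
Proof. by apply: mulg1_eq; exact: hs_mul. Qed.

Lemma hs_commute k l :
  ((k.+1 < l) || (l.+1 < k))%N -> commute (hs g k) (hs g l).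
Proof.
move=> kl; have := hrel_eval (hrel_comm g kl).
by rewrite /word_eval !big_cons !big_nil !mulg1.
Qed.

Lemma hs_braid k l : (k.+1 == l) || (l.+1 == k) ->
  hs g k * hs g l * hs g k = hs g l * hs g k * hs g l.
Proof.
move=> kl; have := hrel_eval (hrel_braid g kl).
by rewrite /word_eval !big_cons !big_nil !mulg1 !mulgA.
Qed.

Lemma hs_ht_commute u k : (0 < k)%N -> commute (hs g k) (ht n u).
Proof.
move=> k_gt0; have := hrel_eval (hrel_ts u k_gt0).
by rewrite /word_eval !big_cons !big_nil !mulg1.
Qed.

Lemma ht_commute u v k : k = 0%N :> nat ->
  commute (ht n u) (hs g k * ht n v * hs g k).
Proof.
move=> k0; have := hrel_eval (hrel_tt v u k0).
by rewrite /word_eval !big_cons !big_nil !mulg1 /commute !mulgA.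
Qed.

(** * Jucys-Murphy elements *)

Lemma JM0 u i : i = 0%N :> nat -> JM u i = ht n u.
Proof.
by move=> i0; rewrite /JM !big_pred0 ?mulg1 ?mul1g // => k; rewrite i0.
Qed.

Lemma filter_ltnS_enum m (k : 'I_m) :
  [seq l : 'I_m <- enum 'I_m | (l < k.+1)%N] =
  rcons [seq l : 'I_m <- enum 'I_m | (l < k)%N] k.
Proof.
have val_filter p : (p <= m)%N ->
    map val [seq l : 'I_m <- enum 'I_m | (l < p)%N] = iota 0 p.
  by move=> pm; rewrite -(filter_iota_ltn 0 pm) -val_enum_ord filter_map.
apply: (inj_map val_inj); rewrite map_rcons !val_filter // 1?ltnW //.
by rewrite -addn1 iotaD cats1.
Qed.

Lemma JMS u i j k : i = k :> nat -> j = k.+1 :> nat ->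
  JM u j = hs g k * JM u i * hs g k.
Proof.
move=> ik jk; rewrite /JM -[in LHS]big_filter -[X in _ * X = _]big_filter.
rewrite ik jk filter_rev filter_ltnS_enum rev_rcons big_cons big_rcons /=.
by rewrite -filter_rev !big_filter !mulgA.
Qed.

Lemma hs_JM_lt u i k : (i < k)%N -> commute (hs g k) (JM u i).
Proof.
move=> ik; have hs_comm l : (l < i)%N -> commute (hs g k) (hs g l).
  by move=> li; apply: hs_commute; rewrite (leq_ltn_trans li ik) orbT.
apply: commuteM; last exact: commute_prod.
apply: commuteM; first exact: commute_prod.
exact/hs_ht_commute/(leq_ltn_trans (leq0n i)).
Qed.

Lemma braid_commute (a b x : W) :
  a * b * a = b * a * b -> commute b x -> commute a (b * (a * x * a) * b).
Proof.
move=> aba bx; rewrite /commute !mulgA aba -!mulgA (mulgA b x) bx.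
by rewrite !mulgA -(mulgA _ b a) -(mulgA _ (b * a) b) -aba !mulgA.
Qed.

(** By induction on i.  For i > k + 2, [hs k] commutes with the outermost
    factor of [JM u i].  For i = k + 2 the element is the conjugate of
    [JM u k] by [hs k.+1 * hs k], and the braid relation moves [hs k] through
    it as [hs k.+1], which commutes with [JM u k]. *)
Lemma hs_JM_gt u i k : (k.+1 < i)%N -> commute (hs g k) (JM u i).
Proof.
have [p ip] : exists p, p = i :> nat by exists i.
elim: p i ip => [|p IHp] i ip ki; first by rewrite -ip in ki.
have p_lt : (p < n.-1)%N by rewrite ltn_predRL ip.
have pn : (p < n)%N by rewrite (leq_trans p_lt) ?leq_pred.
rewrite (@JMS u (Ordinal pn) i (Ordinal p_lt)) //.
have := ki; rewrite -ip ltnS leq_eqVlt => /predU1P[kp|kp]; last first.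
  have hs_comm : commute (hs g k) (hs g (Ordinal p_lt)).
    by apply: hs_commute; rewrite /= kp.
  by apply: (commuteM (commuteM _ _)) => //; apply: IHp.
have kn : (k < n)%N by rewrite (leq_trans (ltn_ord k)) ?leq_pred.
rewrite (@JMS u (Ordinal kn) _ k) //.
apply: braid_commute; first by apply: hs_braid; rewrite /= kp eqxx.
by apply: hs_JM_lt; rewrite /= -kp.
Qed.

(** The index j does not depend on u, being the image of i under the
    transposition of k and k + 1; the cases i = k and i = k + 1 use that
    [hs k] is an involution. *)
Lemma hs_JM i k : exists j, forall u, hs g k * JM u i = JM u j * hs g k.
Proof.
have kn : (k.+1 < n)%N by rewrite -ltn_predRL.
case: (ltngtP i k) => [ik|ki|ik].
- by exists i => u; apply: hs_JM_lt.
- have := ki; rewrite leq_eqVlt => /predU1P[ki1|ki1]; last first.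
    by exists i => u; apply: hs_JM_gt.
  exists (Ordinal (ltnW kn)) => u.
  by rewrite (@JMS u (Ordinal (ltnW kn)) i k) // !mulgA hs_mul mul1g.
- exists (Ordinal kn) => u.
  by rewrite (@JMS u i (Ordinal kn) k) // -mulgA hs_mul mulg1.
Qed.

Lemma ht_JM_commute u v j : (0 < j)%N -> commute (ht n u) (JM v j).
Proof.
have [p jp] : exists p, p = j :> nat by exists j.
elim: p j jp => [|p IHp] j jp j_gt0; first by rewrite -jp in j_gt0.
have p_lt : (p < n.-1)%N by rewrite ltn_predRL jp.
have pn : (p < n)%N by rewrite (leq_trans p_lt) ?leq_pred.
rewrite (@JMS v (Ordinal pn) j (Ordinal p_lt)) //.
case: (posnP p) => [p0|p_gt0]; first by rewrite JM0 //; apply: ht_commute.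
have hs_comm : commute (ht n u) (hs g (Ordinal p_lt)).
  exact/commute_sym/hs_ht_commute.
by apply: (commuteM (commuteM _ _)) => //; apply: IHp.
Qed.

(** [JM u i] with i > 0 is built from [JM u 0] by conjugation with [hs k] for
    k < i, and all of these commute with [JM v j]. *)
Lemma JM_commute u v i j : (i < j)%N -> commute (JM u i) (JM v j).
Proof.
move=> ij; have hs_comm k : (k < i)%N -> commute (JM v j) (hs g k).
  by move=> ki; apply/commute_sym/hs_JM_gt/(leq_ltn_trans ki).
apply: commute_sym; apply: commuteM; last exact: commute_prod.
apply: commuteM; first exact: commute_prod.
exact/commute_sym/ht_JM_commute/(leq_ltn_trans (leq0n i)).
Qed.

(** * Normal forms *)

Lemma hSym1 : @hSym g n 1.
Proof. by move=> H [H1 _] _. Qed.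

Lemma hSym_hsM k (w : W) : hSym w -> hSym (hs g k * w).
Proof.
move=> wS H H_closed hsH; apply: group_closedM => //; last exact: wS.
by apply: hsH; exists k.
Qed.

Definition JM_power (x : 'I_g * 'I_n * int) : W := expgz (JM x.1.1 x.1.2) x.2.

(** The monomial s' has its positions permuted, so it is in general unsorted
    even when s is sorted; sorting is postponed to the end. *)
Lemma hs_JM_powers k s : exists s',
  hs g k * \prod_(x <- s) JM_power x = \prod_(x <- s') JM_power x * hs g k.
Proof.
elim: s => [|[[u i] a] s [s' IHs]].
  by exists [::]; rewrite big_nil mulg1 mul1g.
have [j ijE] := hs_JM i k; exists ((u, j, a) :: s').
by rewrite !big_cons mulgA (expgz_intertwine _ (ijE u)) -mulgA IHs mulgA.
Qed.

Lemma JM_factorization (n_gt0 : (0 < n)%N) (z : W) : exists s w,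
  hSym w /\ z = \prod_(x <- s) JM_power x * w.
Proof.
rewrite -[z]preprK -word_eval_pgen /word_eval.
elim: (prepr z) => [|[[u|k] b] p [s [w [wS IHp]]]].
- by exists [::], 1; rewrite !big_nil mulg1; split=> //; apply: hSym1.
- (* the exponent Negz 0 is -1 *)
  exists ((u, Ordinal n_gt0, if b then Negz 0 else Posz 1) :: s), w.
  split=> //; rewrite !big_cons IHp mulgA; congr (_ * _ * _).
  by rewrite /JM_power /= JM0 //; case: b.
- have [s' s'E] := hs_JM_powers k s; exists s', (hs g k * w).
  split; first exact: hSym_hsM.
  rewrite big_cons IHp mulgA [RHS]mulgA -s'E; congr (_ * _ * _).
  by case: b => //=; exact: hs_inv.
Qed.

Lemma sorted_JM_factorization (n_gt0 : (0 < n)%N) (z : W) :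
  exists w m (a : 'I_m -> int) (u : 'I_m -> 'I_g) (i : 'I_m -> 'I_n),
    [/\ hSym w, forall p q : 'I_m, (p <= q)%N -> (i p <= i q)%N &
        z = \prod_(p < m) expgz (JM (u p) (i p)) (a p) * w].
Proof.
have [s0 [w [wS ->]]] := JM_factorization n_gt0 z.
pose le := relpre (fun x : 'I_g * 'I_n * int => x.1.2 : nat) leq.
have le_total : total le by move=> x y; apply: leq_total.
have le_trans : transitive le by move=> y x t; apply: leq_trans.
have comm x y : ~~ le x y -> commute (JM_power x) (JM_power y).
  rewrite -ltnNge => yx; apply/expgz_commute/commute_sym; exact: JM_commute.
have [s s_sorted <-] := commuting_sort le_total le_trans comm s0.
pose x p := tnth (in_tuple s) p.
exists w, (size s).
exists (fun p => (x p).2), (fun p => (x p).1.1), (fun p => (x p).1.2).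
split=> // [p q pq|]; last by rewrite big_tnth.
have le_refl : reflexive le by move=> y; apply: leqnn.
have xE (r : 'I_(size s)) : nth (x p) s r = x r.
  by rewrite /x [RHS](tnth_nth (x p)).
have := sorted_leq_nth le_trans le_refl (x p) s_sorted.
by move=> /(_ _ _ (ltn_ord p) (ltn_ord q) pq); rewrite /le /= !xE.
Qed.

End Handlebody.

Theorem proposition3p15 (g n : nat) (n_gt0 : (0 < n)%N) :
  @is_basis int (group_alg int (handlebody g n))
    [set x | exists (w : handlebody g n) (m : nat) (a : 'I_m -> int)
                    (u : 'I_m -> 'I_g) (i : 'I_m -> 'I_n),
       [/\ hSym w,
           (forall j k : 'I_m, (j <= k)%N -> (i j <= i k)%N) &
           x = galg_of int
                 ((\prod_(j < m) expgz (JM (u j) (i j)) (a j)) * w)%g]].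
Proof.
apply: group_elements_basis; apply/seteqP; split=> x /=.
  by move=> [w [m [a [u [i [_ _ ->]]]]]]; eexists.
move=> [z _ <-].
have [w [m [a [u [i [wS i_mono zE]]]]]] := sorted_JM_factorization n_gt0 z.
by exists w, m, a, u, i; split; rewrite // zE.
Qed.
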